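(* Let $N,d\ge 1$ and let $f_1,\dots,f_N:\mathbb R^d\to\mathbb R$ be convex functions such that $L_i:=\sup_{z\in\mathbb R^d}\sup_{g\in\partial f_i(z)}\|g\|_1<\infty$ for each $i$, and such that $f:=\sum_{i=1}^N f_i$ has at least one minimizer on $\mathbb R^d$. Let $\tilde P(t)=(\tilde p_{ij}(t))$, $t\ge0$, be $N\times N$ row-stochastic matrices, let $\tilde\Delta(t)=\operatorname{diag}(\tilde\delta_1(t),\dots,\tilde\delta_N(t))$ with real $\tilde\delta_i(t)$, and let $\tilde x_i(t)\in\mathbb R^d$ satisfy $$\tilde x_i(t+1)=\sum_{j=1}^N\tilde p_{ij}(t)\big(\tilde x_j(t)-\tilde\delta_j(t)\tilde g_j(t)\big),\qquad \tilde g_i(t)\in\partial f_i(\tilde x_i(t)),\qquad 1\le i\le N,\ t\ge 0,$$ with arbitrary initial data. Suppose that the following hold. (1) $\tilde p^+:=\inf_{t\ge0}\big[\min_{i,j:\,\tilde p_{ij}(t)>0}\tilde p_{ij}(t)\big]>0$, and there is $T\in\mathbb N$ such that $\tilde P(t+T,t)>0$ for all $t\ge 0$. (2) $\tilde\delta_i(t)\ge0$ for all $i,t$, and $\sum_{t=0}^\infty\big(\|\tilde\Delta(t)\|\sup_{\ell\ge t}\|\tilde\Delta(\ell)\|\big)<\infty$. (3) The set of absolute probability vectors $\tilde\pi(t)=(\tilde\pi_1(t),\dots,\tilde\pi_N(t))^\top$, $t\ge0$, for $\{\tilde P(t)\}_{t\ge0}$ (which exists and is unique under (1)) satisfies $\sum_{t=0}^\infty\|\tilde\Delta(t)\tilde\pi(t)\|=\infty$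 and $\sum_{t=0}^\infty\sqrt t\,\max_{i,j}|\tilde\pi_i(t)\tilde\delta_i(t)-\tilde\pi_j(t)\tilde\delta_j(t)|<\infty$. Then there exists a minimizer $x^*$ of $f$ such that $\lim_{t\to\infty}\tilde x_i(t)=x^*$ for all $1\le i\le N$.
   Context: A nonnegative square matrix is row-stochastic if each of its rows sums to $1$. For a matrix $A$, $A>0$ means every entry is positive. $\partial f_i(z)$ is the (convex) subdifferential of $f_i$ at $z$, and $\|g\|_1=\sum_l|g_l|$. Backward products: $\tilde P(t,t_0):=\tilde P(t-1)\tilde P(t-2)\cdots\tilde P(t_0)$ for $t>t_0\ge0$, and $\tilde P(t_0,t_0):=I_N$. A probability vector is a nonnegative vector whose entries sum to $1$. A sequence $\{\tilde\pi(t)\}_{t\ge0}$ of probability vectors is a set of absolute probability vectors for $\{\tilde P(t)\}_{t\ge0}$ if $\tilde\pi(t+1)^\top\tilde P(t)=\tilde\pi(t)^\top$ for all $t\ge0$. $\|\cdot\|$ denotes any norm (matrix norms sub-multiplicative); the conditions do not depend on the choice. *)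

(* Defs.v *)
From HB Require Import structures.
From mathcomp Require Import all_boot all_order all_algebra.
From mathcomp Require Import all_classical all_reals all_analysis.

Set Implicit Arguments.
Unset Strict Implicit.
Unset Printing Implicit Defensive.

Import Order.TTheory GRing.Theory Num.Theory.
Import numFieldNormedType.Exports.

Local Open Scope classical_set_scope.
Local Open Scope ring_scope.

(* [nu] is an arbitrary function, so that norms other than the library's
   canonical (max-entry) norm on matrices can be considered; nonnegativity
   follows from the three fields. *)
Record is_norm (R : realType) (V : lmodType R) (nu : V -> R) : Prop := IsNorm {
  norm_definite : forall v, nu v = 0 -> v = 0;
  norm_homog : forall (a : R) v, nu (a *: v) = `|a| * nu v;
  norm_triangle : forall u v, nu (u + v) <= nu u + nu v
}.

Record is_matrix_norm (R : realType) (N : nat) (nu : 'M[R]_N -> R) : Prop :=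
  IsMatrixNorm {
    matrix_norm_norm : is_norm nu;
    matrix_norm_submult : forall A B, nu (A *m B) <= nu A * nu B
  }.

Section Vectors.
Variables (R : realType) (d : nat).
Implicit Types (u v g y z : 'cV[R]_d) (f : 'cV[R]_d -> R).

Definition dotv u v : R := \sum_(l < d) u l 0 * v l 0.

Definition norm1 g : R := \sum_(l < d) `|g l 0|.

Definition subdifferential f z : set 'cV[R]_d :=
  [set g | forall y, f z + dotv g (y - z) <= f y].

Definition subgradient_sup f : \bar R :=
  ereal_sup [set ereal_sup [set (norm1 g)%:E | g in subdifferential f z]
            | z in [set: 'cV[R]_d]].

Definition is_minimizer f z : Prop := forall y, f z <= f y.

End Vectors.

Section Matrices.
Variables (R : realType) (N : nat).
Implicit Types (A : 'M[R]_N) (P : nat -> 'M[R]_N) (w : 'cV[R]_N).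

Definition row_stochastic A : Prop :=
  (forall i j, 0 <= A i j) /\ (forall i, \sum_(j < N) A i j = 1).

Definition positive_mx A : Prop := forall i j, 0 < A i j.

Definition probability_vector w : Prop :=
  (forall i, 0 <= w i 0) /\ \sum_(i < N) w i 0 = 1.

(* For t0 <= t this is P(t-1) *m P(t-2) *m ... *m P(t0), with value 1%:M when
   t = t0. *)
Definition backward_product P (t t0 : nat) : 'M[R]_N :=
  \big[mulmx/1%:M]_(k < t - t0) P (t - k.+1)%N.

Definition absolute_probability_vectors P (pi : nat -> 'cV[R]_N) : Prop :=
  (forall t, probability_vector (pi t)) /\
  (forall t, (pi t.+1)^T *m P t = (pi t)^T).

(* The infimum over t of the minimal positive entry of P(t); each inner minimum
   is over a nonempty set when P(t) is row-stochastic and 0 < N. *)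
Definition inf_positive_entry P : \bar R :=
  ereal_inf [set \big[mine/+oo%E]_(ij : 'I_N * 'I_N | 0 < P t ij.1 ij.2)
                    (P t ij.1 ij.2)%:E
            | t in [set: nat]].

Definition stepsize_mx (delta : nat -> 'I_N -> R) (t : nat) : 'M[R]_N :=
  diag_mx (\row_i delta t i).

(* The default value 0 of the maximum is harmless, the terms being
   nonnegative. *)
Definition max_discrepancy (pi : nat -> 'cV[R]_N) (delta : nat -> 'I_N -> R)
    (t : nat) : R :=
  \big[Num.max/0]_(ij : 'I_N * 'I_N)
     `|pi t ij.1 0 * delta t ij.1 - pi t ij.2 0 * delta t ij.2|.

End Matrices.

(* Main.v *)
(* With y(t) = sum_i pi_i(t) x_i(t) one has
   y(t+1) = y(t) - sum_j pi_j delta_j g_j. Positivity of the T-step products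
   contracts the diameter S(t) of {x_i(t)}, so square summability of the step
   sizes makes S square summable. As the weights pi_j delta_j agree with
   alpha = pi_0 delta_0 up to a summable discrepancy, for each minimizer z,
   |y - z|^2 decreases by 2 alpha (f(y) - f(z)) up to summable errors and a
   summable multiplicative factor. Hence y is bounded, and since sum alpha
   diverges, f(y) comes close to min f along a subsequence, which has a cluster
   point; that point is a minimizer, and quasi-Fejer monotonicity with respect
   to it forces y, then every x_i, to converge to it. The global Lipschitz
   bounds come from the existence of subgradients. *)

Require Import Defs.
From HB Require Import structures.
From mathcomp Require Import all_boot all_order all_algebra.
From mathcomp Require Import all_classical all_reals all_analysis.
From mathcomp Require Import ring lra.

Set Implicit Arguments.
Unset Strict Implicit.
Unset Printing Implicit Defensive.

Import Order.TTheory GRing.Theory Num.Theory.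
Import numFieldNormedType.Exports.

Local Open Scope classical_set_scope.
Local Open Scope ring_scope.

(** * Summable real series, quasi-Fejer recursions, delayed contractions *)

Section RealSeries.
Variable R : realType.
Implicit Types (a b c e F U S : nat -> R) (C M eta eps : R).

(** For nonnegative terms this is summability, kept in real arithmetic rather than in extended
    reals. *)
Definition bounded_series a := exists M, forall n, \sum_(t < n) a t <= M.

Lemma bounded_seriesD a b : bounded_series a -> bounded_series b ->
  bounded_series (fun t => a t + b t).
Proof.
by move=> [M hM] [K hK]; exists (M + K) => n; rewrite big_split lerD.
Qed.

Lemma bounded_seriesZ C a : 0 <= C -> bounded_series a ->
  bounded_series (fun t => C * a t).
Proof.
by move=> C0 [M hM]; exists (C * M) => n; rewrite -mulr_sumr ler_wpM2l.
Qed.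

Lemma bounded_series_le a b : (forall t, a t <= b t) -> bounded_series b ->
  bounded_series a.
Proof.
by move=> ab [M hM]; exists M => n; apply: le_trans (hM n); apply: ler_sum.
Qed.

Lemma bounded_series_shift a k : (forall t, 0 <= a t) -> bounded_series a ->
  bounded_series (fun t => a (t + k)%N).
Proof.
move=> a0 [M hM]; exists M => n; apply: le_trans (hM (k + n)%N).
rewrite big_split_ord /= -[leLHS]add0r lerD ?sumr_ge0//.
by apply: ler_sum => t _; rewrite addnC.
Qed.

(** Once a partial sum lies within [eps] of the supremum of all partial sums, no later block can add
    more than [eps]. *)
Lemma bounded_series_tail a eps : (forall t, 0 <= a t) -> bounded_series a ->
  0 < eps -> exists n, forall m, \sum_(t < m) a (n + t)%N <= eps.
Proof.
move=> a0 [M hM] eps0.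
pose A := [set \sum_(t < n) a t | n in [set: nat]].
have supA : has_sup A.
  by split; [exists (\sum_(t < 0) a t); exists 0%N|exists M => _ [n _ <-]].
have [_ [n _ <-] hn] := sup_adherent eps0 supA.
exists n => m; have : \sum_(t < n + m) a t <= sup A.
  by apply: sup_upper_bound => //; exists (n + m)%N.
by rewrite big_split_ord /=; lra.
Qed.

Lemma bounded_series_nneseries a : (forall t, 0 <= a t) ->
  (\sum_(0 <= t <oo) (a t)%:E < +oo)%E -> bounded_series a.
Proof.
move=> a0 afin; have an t : (0 <= (a t)%:E)%E by rewrite lee_fin.
have ssup n : ((\sum_(t < n) a t)%:E <= \sum_(0 <= t <oo) (a t)%:E)%E.
  rewrite -sumEFin -(big_mkord xpredT (fun t => (a t)%:E)).
  exact: nneseries_lim_ge.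
have afn : (\sum_(0 <= t <oo) (a t)%:E)%E \is a fin_num.
  by rewrite ge0_fin_numE// nneseries_ge0.
exists (fine (\sum_(0 <= t <oo) (a t)%:E)%E) => n.
by rewrite -lee_fin fineK.
Qed.

Lemma nneseries_bounded_series a : (forall t, 0 <= a t) ->
  bounded_series a -> (\sum_(0 <= t <oo) (a t)%:E < +oo)%E.
Proof.
move=> a0 [M hM]; apply: (@le_lt_trans _ _ M%:E); last exact: ltry.
apply: lime_le; first by apply: is_cvg_nneseries => n _ _; rewrite lee_fin.
by apply: nearW => n; rewrite sumEFin lee_fin big_mkord.
Qed.

(** If [F] stayed above [eps] from [n] on, then [a t <= eps^-1 * (a t * F t)] there, and the series
    of [a] would be bounded. *)
Lemma series_dominate_liminf0 a F : (forall t, 0 <= a t) ->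
  ~ bounded_series a -> bounded_series (fun t => a t * F t) ->
  (forall t, 0 <= F t) ->
  forall eps n, 0 < eps -> exists2 t, (n <= t)%N & F t < eps.
Proof.
move=> a0 ainf [M hM] F0 eps n eps0; apply: contrapT => hF; apply: ainf.
have FE t : (n <= t)%N -> eps <= F t.
  by move=> nt; rewrite leNgt; apply/negP => Ft; apply: hF; exists t.
exists (\sum_(t < n) a t + eps^-1 * M) => m.
have -> : \sum_(t < n) a t + eps^-1 * M =
    eps^-1 * (eps * (\sum_(t < n) a t) + M) by field; rewrite gt_eqF.
rewrite ler_pdivlMl//; apply: (@le_trans _ _
    (eps * (\sum_(t < n) a t) + \sum_(t < n + m) a t * F t)); last first.
  by rewrite lerD2l.
rewrite big_split_ord /= addrA.
apply: (@le_trans _ _ (eps * \sum_(t < n + m) a t)).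
  apply: ler_wpM2l; first exact: ltW.
  by rewrite addnC big_split_ord /= lerDl sumr_ge0.
rewrite big_split_ord mulrDr /=; apply: lerD.
  by rewrite lerDl sumr_ge0// => t _; rewrite mulr_ge0.
rewrite mulr_sumr; apply: ler_sum => t _.
by rewrite mulrC ler_wpM2l// FE// leq_addr.
Qed.

(** * Quasi-Fejer recursions with summable relative and absolute errors *)

Section QuasiFejer.
Variables (U F a b c : nat -> R).
Hypotheses (U0 : forall t, 0 <= U t) (F0 : forall t, 0 <= F t).
Hypotheses (a0 : forall t, 0 <= a t) (b0 : forall t, 0 <= b t).
Hypotheses (c0 : forall t, 0 <= c t).
Hypotheses (bB : bounded_series b) (cB : bounded_series c).
Hypothesis UE : forall t, U t.+1 <= (1 + c t) * U t - a t * F t + b t.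

(** Discrete Gronwall argument: [1 + c t <= expR (c t)], so the accumulated factors stay below the
    exponential of the sum of [c]. *)
Lemma quasi_fejer_bounded : exists B, forall t, U t <= B.
Proof.
have [Mb hMb] := bB; have [Mc hMc] := cB.
exists (expR Mc * (U 0%N + Mb)) => t.
apply: (@le_trans _ _ (expR (\sum_(s < t) c s) * (U 0%N + \sum_(s < t) b s))).
  elim: t => [|t IH]; first by rewrite !big_ord0 expR0 mul1r addr0.
  rewrite !big_ord_recr /= expRD.
  set E := expR (\sum_(s < t) c s) in IH *.
  set B := \sum_(s < t) b s in IH *.
  have E1 : 1 <= E.
    by rewrite -expR0 ler_expR sumr_ge0.
  have B0 : 0 <= B by rewrite sumr_ge0.
  have e1 : 1 + c t <= expR (c t) by exact: expR_ge1Dx.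
  have := UE t; have := mulr_ge0 (a0 t) (F0 t).
  have : (1 + c t) * U t <= (1 + c t) * (E * (U 0%N + B)).
    by rewrite ler_wpM2l// addr_ge0.
  have : (1 + c t) * (E * (U 0%N + B)) <= expR (c t) * (E * (U 0%N + B)).
    by rewrite ler_wpM2r// mulr_ge0// ?addr_ge0// (le_trans _ E1).
  have : b t <= E * expR (c t) * b t.
    rewrite -[leLHS]mul1r ler_wpM2r// -[leLHS]mulr1 ler_pM//.
    by rewrite (le_trans _ e1)// lerDl.
  have -> : E * expR (c t) * (U 0%N + (B + b t)) =
    expR (c t) * (E * (U 0%N + B)) + E * expR (c t) * b t by ring.
  lra.
apply: ler_pM; rewrite ?expR_ge0 ?ler_expR//.
  by rewrite addr_ge0// sumr_ge0.
by rewrite lerD2l.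
Qed.

(** Boundedness of [U] turns the relative error [c t * U t] into a summable additive one. *)
Lemma quasi_fejer_perturbation : exists e,
  [/\ forall t, 0 <= e t, bounded_series e &
      forall t, U t.+1 <= U t - a t * F t + e t].
Proof.
have [B hB] := quasi_fejer_bounded.
have B0 : 0 <= B by apply: le_trans (hB 0%N).
exists (fun t => B * c t + b t); split => [t||t].
- by rewrite addr_ge0// mulr_ge0.
- by apply: bounded_seriesD => //; apply: bounded_seriesZ.
- by have := UE t; have := ler_wpM2l (c0 t) (hB t); nra.
Qed.

Lemma quasi_fejer_summable : bounded_series (fun t => a t * F t).
Proof.
have [e [e0 [M hM] Ue]] := quasi_fejer_perturbation.
exists (U 0%N + M) => n.
suff : \sum_(t < n) a t * F t + U n <= U 0%N + \sum_(t < n) e t.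
  by have := U0 n; have := hM n; lra.
elim: n => [|n IH]; first by rewrite !big_ord0 addr0 add0r.
by rewrite !big_ord_recr /=; have := Ue n; lra.
Qed.

(** Start from a late time at which [U] is below [eps / 2]; the errors accumulated afterwards add at
    most another [eps / 2]. *)
Lemma quasi_fejer_cvg0 :
  (forall eps n, 0 < eps -> exists2 t, (n <= t)%N & U t < eps) ->
  forall eps, 0 < eps -> exists n, forall t, (n <= t)%N -> U t < eps.
Proof.
have [e [e0 eB Ue]] := quasi_fejer_perturbation.
move=> liminfU eps eps0; have eps20 : 0 < eps / 2 by rewrite divr_gt0.
have [n hn] := bounded_series_tail e0 eB eps20.
have [t nt Ut] := liminfU _ n eps20.
exists t => s ts; have [k ->] : exists k, s = (t + k)%N.
  by exists (s - t)%N; rewrite subnKC.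
have step : U (t + k)%N <= U t + \sum_(r < k) e (t + r)%N.
  elim: k => [|k IH]; first by rewrite addn0 big_ord0 addr0.
  rewrite addnS big_ord_recr /=.
  by have := Ue (t + k)%N; have := mulr_ge0 (a0 (t + k)%N) (F0 (t + k)%N); lra.
have : \sum_(r < k) e (t + r)%N <= eps / 2.
  apply: le_trans (hn (t - n + k)%N).
  rewrite big_split_ord /= -[leLHS]add0r lerD ?sumr_ge0//.
  by apply: ler_sum => r _; rewrite addnA subnKC.
by lra.
Qed.

End QuasiFejer.

Lemma sqr_sum_le T (a : nat -> R) :
  (\sum_(r < T) a r) ^+ 2 <= T%:R * \sum_(r < T) a r ^+ 2.
Proof.
elim: T => [|T IH]; first by rewrite !big_ord0 mul0r expr0n.
rewrite !big_ord_recr /=.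
set s := \sum_(r < T) a r in IH *; set q := \sum_(r < T) a r ^+ 2 in IH *.
have cross : 2 * s * a T <= q + T%:R * a T ^+ 2.
  rewrite /s /q mulr_sumr mulr_suml.
  have -> : T%:R * a T ^+ 2 = \sum_(r < T) a T ^+ 2.
    by rewrite sumr_const card_ord mulr_natl.
  rewrite -big_split /=; apply: ler_sum => r _.
  by have := sqr_ge0 (a r - a T); lra.
by rewrite -natr1; lra.
Qed.

(** Convexity of the square, with weights [1 - eta] and [eta], gives a recursion for [S t ^+ 2];
    summing it leaves a fraction [eta] of the sum to be bounded. *)
Lemma delayed_contraction_square_summable S e T C eta :
  0 < eta -> eta <= 1 -> 0 <= C -> (forall t, 0 <= S t) ->
  bounded_series (fun t => e t ^+ 2) ->
  (forall t, S (t + T)%N <= (1 - eta) * S t + C * \sum_(r < T) e (t + r)%N) ->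
  bounded_series (fun t => S t ^+ 2).
Proof.
move=> eta0 eta1 C0 S0 eB SE.
pose E t := \sum_(r < T) e (t + r)%N.
have EB : bounded_series (fun t => E t ^+ 2).
  apply: (@bounded_series_le _ (fun t => T%:R * \sum_(r < T) e (t + r)%N ^+ 2)).
    by move=> t; apply: (sqr_sum_le T (fun r => e (t + r)%N)).
  (* With the factor [T%:R] removed, induction on the window length adds one shifted copy of the
     series of [e t ^+ 2] at a time. *)
  apply: bounded_seriesZ => //; move: (T) => k.
  elim: k => [|k IH].
    by exists 0 => n; rewrite big1// => t _; rewrite big_ord0.
  under [fun t => _]funext do rewrite big_ord_recr.
  apply: bounded_seriesD => //.
  by apply: (bounded_series_shift k _ eB) => t; rewrite sqr_ge0.
have S2E t : S (t + T)%N ^+ 2 <= (1 - eta) * S t ^+ 2 + C ^+ 2 / eta * E t ^+ 2.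
  have h : S (t + T)%N ^+ 2 <= ((1 - eta) * S t + C * E t) ^+ 2.
    by rewrite ler_sqr ?nnegrE// (le_trans _ (SE t)).
  apply: (le_trans h); rewrite -subr_ge0.
  (* The convexity gap between the points [S t] and [C * E t / eta]. *)
  have -> : (1 - eta) * S t ^+ 2 + C ^+ 2 / eta * E t ^+ 2 -
    ((1 - eta) * S t + C * E t) ^+ 2 =
    (1 - eta) * eta * (S t - C * E t / eta) ^+ 2 by field; rewrite gt_eqF.
  by rewrite mulr_ge0 ?sqr_ge0// mulr_ge0 ?subr_ge0// ltW.
have [M hM] := bounded_seriesZ (divr_ge0 (sqr_ge0 C) (ltW eta0)) EB.
(* [K] pays for the first [T] squares, which the delayed recursion does not reach. *)
pose K := \sum_(t < T) S t ^+ 2.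
exists (eta^-1 * (K + M)) => n; rewrite ler_pdivlMl//.
have : \sum_(t < n) S t ^+ 2 <= K + \sum_(t < n) S (t + T)%N ^+ 2.
  apply: (@le_trans _ _ (\sum_(t < T + n) S t ^+ 2)).
    by rewrite addnC big_split_ord /= lerDl sumr_ge0// => t _; rewrite sqr_ge0.
  rewrite big_split_ord lerD2l; apply: ler_sum => t _.
  by rewrite /= [(t + T)%N]addnC.
have : \sum_(t < n) S (t + T)%N ^+ 2 <= \sum_(t < n)
    ((1 - eta) * S t ^+ 2 + C ^+ 2 / eta * E t ^+ 2) by apply: ler_sum.
by rewrite big_split -mulr_sumr /=; have := hM n; lra.
Qed.

End RealSeries.

(** * Inner product, max-entry norm and 1-norm on column vectors *)

Section ColumnVectors.
Variables (R : realType) (d : nat).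
Implicit Types (u v w g y z : 'cV[R]_d) (s : R).

Lemma dotvC u v : dotv u v = dotv v u.
Proof. by apply: eq_bigr => l _; rewrite mulrC. Qed.

Lemma dotvDr u v w : dotv u (v + w) = dotv u v + dotv u w.
Proof. by rewrite -big_split; apply: eq_bigr => l _; rewrite mxE mulrDr. Qed.

Lemma dotvZr s u v : dotv u (s *: v) = s * dotv u v.
Proof. by rewrite mulr_sumr; apply: eq_bigr => l _; rewrite mxE mulrCA. Qed.

Lemma dotvNr u v : dotv u (- v) = - dotv u v.
Proof. by rewrite -scaleN1r dotvZr mulN1r. Qed.

Lemma dotvBr u v w : dotv u (v - w) = dotv u v - dotv u w.
Proof. by rewrite dotvDr dotvNr. Qed.

Lemma dotvDl u v w : dotv (v + w) u = dotv v u + dotv w u.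
Proof. by rewrite dotvC dotvDr !(dotvC u). Qed.

Lemma dotvZl s u v : dotv (s *: v) u = s * dotv v u.
Proof. by rewrite dotvC dotvZr dotvC. Qed.

Lemma dotvBB u v : dotv (u - v) (u - v) = dotv u u - 2 * dotv v u + dotv v v.
Proof. by rewrite dotvBr !(dotvC (u - v)) !dotvBr (dotvC u v); ring. Qed.

Lemma dotv0r u : dotv u 0 = 0.
Proof. by rewrite /dotv big1// => l _; rewrite mxE mulr0. Qed.

Lemma dotv_suml (I : finType) (G : I -> 'cV[R]_d) u :
  dotv (\sum_i G i) u = \sum_i dotv (G i) u.
Proof.
rewrite /dotv exchange_big; apply: eq_bigr => l _.
by rewrite summxE mulr_suml.
Qed.

Lemma dotv_delta u l : dotv u (delta_mx l 0) = u l 0.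
Proof.
rewrite /dotv (bigD1 l)//= big1 ?addr0 ?mxE ?eqxx ?mulr1// => j jl.
by rewrite mxE (negbTE jl) mulr0.
Qed.

Lemma dotvv_ge0 u : 0 <= dotv u u.
Proof. by apply: sumr_ge0 => l _; rewrite -expr2 sqr_ge0. Qed.

Lemma le_norm_cV u l : `|u l 0| <= `|u|.
Proof.
rewrite /Num.norm /= mx_normrE.
exact: (le_bigmax _ (fun ij => `|u ij.1 ij.2|) (l, 0)).
Qed.

Lemma norm_cV_le u s : 0 <= s -> (forall l, `|u l 0| <= s) -> `|u| <= s.
Proof.
move=> s0 us; rewrite /Num.norm /= mx_normrE.
apply: bigmax_le => // -[l j] _ /=.
by rewrite ord1.
Qed.

(** The library norm is the max-entry norm, while the descent argument is Euclidean; this and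
    [dotvv_le_sqr] pass between the two. *)
Lemma sqr_norm_le_dotv u : `|u| ^+ 2 <= dotv u u.
Proof.
rewrite -ler_sqrt ?sqr_ge0 ?dotvv_ge0// sqrtr_sqr normr_id.
apply: norm_cV_le => // l; rewrite -sqrtr_sqr ler_sqrt ?dotvv_ge0//.
rewrite /dotv (bigD1 l)//= -expr2 lerDl sumr_ge0// => j _.
by rewrite -expr2 sqr_ge0.
Qed.

Lemma norm1_ge0 g : 0 <= norm1 g.
Proof. exact: sumr_ge0. Qed.

Lemma norm_le_norm1 u : `|u| <= norm1 u.
Proof.
apply: norm_cV_le; first exact: norm1_ge0.
by move=> l; rewrite /norm1 (bigD1 l)//= lerDl sumr_ge0.
Qed.

Lemma dotv_norm_le g v : `|dotv g v| <= norm1 g * `|v|.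
Proof.
apply: (le_trans (ler_norm_sum _ _ _)); rewrite mulr_suml.
by apply: ler_sum => l _; rewrite normrM ler_wpM2l// le_norm_cV.
Qed.

Lemma dotvv_le_sqr u : dotv u u <= d%:R * `|u| ^+ 2.
Proof.
apply: (@le_trans _ _ (\sum_(l < d) `|u| ^+ 2)); last first.
  by rewrite sumr_const card_ord mulr_natl.
apply: ler_sum => l _; rewrite -expr2 -real_normK ?num_real//.
by rewrite ler_sqr ?nnegrE// le_norm_cV.
Qed.

Lemma norm1_sum (I : finType) (G : I -> 'cV[R]_d) :
  norm1 (\sum_i G i) <= \sum_i norm1 (G i).
Proof.
rewrite /norm1 exchange_big; apply: ler_sum => l _ /=.
by rewrite summxE; apply: ler_norm_sum.
Qed.

Lemma norm1Z s g : norm1 (s *: g) = `|s| * norm1 g.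
Proof.
by rewrite /norm1 mulr_sumr; apply: eq_bigr => l _; rewrite mxE normrM.
Qed.

(** Bolzano-Weierstrass, transposed to row vectors in order to use the compactness of boxes given by
    [rV_compact]. *)
Lemma bounded_cluster_point (u : nat -> 'cV[R]_d) (B : R) :
  (forall n, `|u n| <= B) ->
  exists p, forall eps n, 0 < eps -> exists2 k, (n <= k)%N & `|u k - p| < eps.
Proof.
move=> uB; pose v n : 'rV[R]_d := (u n)^T.
have vc : compact [set w : 'rV[R]_d | forall i, `[- B, B]%classic (w ord0 i)].
  apply: (@rV_compact R d (fun=> `[- B, B]%classic)) => i.
  exact: segment_compact.
have [|p [_ pc]] := vc (v @ \oo) _.
  exists 0%N => // n _ i /=; rewrite in_itv /= -ler_norml mxE.
  exact: le_trans (le_norm_cV _ _) (uB n).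
exists p^T => eps n eps0.
have : (v @ \oo) (v @` [set k | (n <= k)%N]).
  by exists n => // k nk; exists k.
move=> /pc /(_ (nbhsx_ballx p eps eps0)) [w [[k /= nk <-]]].
rewrite -ball_normE /= => pv; exists k => //; apply: le_lt_trans pv.
apply: norm_cV_le => // l.
have -> : (u k - p^T) l 0 = - (p - v k) 0 l by rewrite !mxE opprB.
rewrite normrN /Num.norm /= mx_normrE.
exact: (le_bigmax _ (fun ij => `|(p - v k) ij.1 ij.2|) (0, l)).
Qed.

End ColumnVectors.

(** * Existence of subgradients and Lipschitz bounds for convex functions *)

Section ConvexFunctions.
Variables (R : realType) (d : nat) (f : 'cV[R]_d -> R).
Hypothesis f_convex : convex_function [set: 'cV[R]_d] f.
Implicit Types (u v g y z : 'cV[R]_d) (s r c L : R).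

Lemma convex_function_ineq s u v : 0 <= s -> s <= 1 ->
  f (s *: u + (1 - s) *: v) <= s * f u + (1 - s) * f v.
Proof.
move=> s0 s1.
by have := f_convex (Itv01 s0 s1) (mem_set I : u \in setT)
  (mem_set I : v \in setT).
Qed.

(* Finite-dimensional Hahn-Banach: the subgradient inequality is extended one
   coordinate at a time. *)
Lemma partial_subgradient z k : (k <= d)%N ->
  exists g, forall y, (forall l : 'I_d, (k <= l)%N -> y l 0 = 0) ->
    f z + dotv g y <= f (z + y).
Proof.
elim: k => [|k IH] kd.
  exists 0 => y y0; have -> : y = 0 by apply/colP => l; rewrite y0// mxE.
  by rewrite dotv0r !addr0.
have [g hg] := IH (ltnW kd).
pose l0 := Ordinal kd; pose e : 'cV[R]_d := delta_mx l0 0.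
pose supp y := forall l : 'I_d, (k <= l)%N -> y l 0 = 0.
have supp0 : supp 0 by move=> l _; rewrite mxE.
(* Every backward slope along [e] lies below every forward slope, so some number separates them. *)
have slopes u v s r : supp u -> supp v -> 0 < s -> 0 < r ->
    (f z + dotv g u - f (z + u - s *: e)) / s <=
    (f (z + v + r *: e) - f z - dotv g v) / r.
  move=> su sv s0 r0; have sr0 : 0 < r + s by rewrite addr_gt0.
  have srN0 : r + s != 0 by rewrite gt_eqF.
  (* The weight for which the components [- s *: e] and [r *: e] cancel in the convex combination,
     leaving a point where [g] already works. *)
  pose q := r / (r + s).
  have q1E : 1 - q = s / (r + s) by rewrite /q; field.
  have q0 : 0 <= q by rewrite divr_ge0// ltW.
  have q1 : q <= 1 by rewrite ler_pdivrMr// mul1r lerDl ltW.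
  have := convex_function_ineq (z + u - s *: e) (z + v + r *: e) q0 q1.
  have -> : q *: (z + u - s *: e) + (1 - q) *: (z + v + r *: e) =
      z + (q *: u + (1 - q) *: v).
    by apply/colP => l; rewrite q1E /q !mxE; field.
  have sw : supp (q *: u + (1 - q) *: v).
    by move=> l kl; rewrite !mxE su// sv// !mulr0 addr0.
  have := hg _ sw; rewrite dotvDr !dotvZr q1E /q => h1 h2.
  rewrite ler_pdivrMr// mulrAC ler_pdivlMr//.
  have := le_trans h1 h2.
  rewrite -(ler_pM2l sr0).
  set A := f (z + u - s *: e); set B := f (z + v + r *: e).
  have -> : (r + s) * (f z + (r / (r + s) * dotv g u + s / (r + s) * dotv g v))
    = (r + s) * f z + r * dotv g u + s * dotv g v by field.
  have -> : (r + s) * (r / (r + s) * A + s / (r + s) * B) = r * A + s * B.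
    by field.
  lra.
pose A := [set c | exists u s, [/\ supp u, 0 < s &
  c = (f z + dotv g u - f (z + u - s *: e)) / s]].
have supA : has_sup A.
  split; first by exists ((f z + dotv g 0 - f (z + 0 - 1 *: e)) / 1), 0, 1.
  exists ((f (z + 0 + 1 *: e) - f z - dotv g 0) / 1) => _ [u [s [su s0 ->]]].
  exact: slopes.
pose c := sup A.
(* This replaces the entry [l0] of [g] by the separating slope [c]. *)
exists (g + (c - g l0 0) *: e) => y y0.
pose s : R := y l0 0; pose y' := y - s *: e.
have yE : y = y' + s *: e by rewrite subrK.
have sy' : supp y'.
  move=> l; rewrite leq_eqVlt => /predU1P[kl|kl].
    have -> : l = l0 by apply/val_inj.
    by rewrite !mxE !eqxx mulr1 subrr.
  by rewrite !mxE y0// -val_eqE /= gtn_eqF// mulr0 subr0.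
have dotE : dotv (g + (c - g l0 0) *: e) y = dotv g y' + c * s.
  rewrite dotvDl dotvZl [dotv e y]dotvC dotv_delta -/s.
  by rewrite {1}yE dotvDr dotvZr dotv_delta; ring.
rewrite dotE yE [z + _]addrA.
(* For [s < 0] use that [c] bounds the backward slopes, for [s > 0] that it is the least such
   bound. *)
have [s0|s0|->] := ltgtP s 0; last by rewrite mulr0 scale0r !addr0 hg.
- have : (f z + dotv g y' - f (z + y' - (- s) *: e)) / (- s) <= c.
    by apply: sup_upper_bound => //; exists y', (- s); rewrite oppr_gt0.
  by rewrite ler_pdivrMr ?oppr_gt0// scaleNr opprK; lra.
- have : c <= (f (z + y' + s *: e) - f z - dotv g y') / s.
    apply: ge_sup; first by case: supA.
    by move=> _ [u [r [su r0 ->]]]; exact: slopes.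
  by rewrite ler_pdivlMr//; lra.
Qed.

Lemma subdifferential_nonempty z : exists g, subdifferential f z g.
Proof.
have [g hg] := partial_subgradient z (leqnn d).
exists g => y; have := hg (y - z); rewrite [z + _]addrC subrK; apply => l.
by rewrite leqNgt ltn_ord.
Qed.

(** A subgradient [g] at [u] gives [f u - f v <= dotv g (u - v)], and the 1-norm is dual to the
    max-entry norm. *)
Lemma bounded_subgradients_lipschitz L :
  (forall z g, subdifferential f z g -> norm1 g <= L) ->
  forall u v, f u - f v <= L * `|u - v|.
Proof.
move=> fL u v; have [g gu] := subdifferential_nonempty u.
have gn := le_trans (ler_norm _) (dotv_norm_le g (u - v)).
have := ler_wpM2r (normr_ge0 (u - v)) (fL _ _ gu).
by have := gu v; rewrite -[v - u]opprB dotvNr; lra.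
Qed.

End ConvexFunctions.

Lemma subgradient_sup_bound (R : realType) (d : nat) (f : 'cV[R]_d -> R) :
  (subgradient_sup f < +oo)%E ->
  exists2 L, 0 <= L & forall z g, subdifferential f z g -> norm1 g <= L.
Proof.
move=> fL.
have fsup z g : subdifferential f z g -> ((norm1 g)%:E <= subgradient_sup f)%E.
  move=> gz; apply: (@le_trans _ _
    (ereal_sup [set (norm1 g)%:E | g in subdifferential f z])).
    by apply: ereal_sup_ubound; exists g.
  by apply: ereal_sup_ubound; exists z.
(* The maximum with 0 makes the bound nonnegative; the value [-oo] means that there are no
   subgradients at all, so 0 works vacuously. *)
case: (subgradient_sup f) fL fsup => [r _ h|//|_ h].
- exists (Num.max r 0) => [|z g /h]; rewrite le_max ?lexx ?orbT//.
  by rewrite lee_fin => ->.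
- by exists 0 => // z g /h; rewrite leeNy_eq.
Qed.

(** * Comparison of arbitrary norms with entries *)

Section Norms.
Variable R : realType.

Lemma is_norm_ge0 (V : lmodType R) (nu : V -> R) : is_norm nu ->
  forall v, 0 <= nu v.
Proof.
move=> [_ nuZ nuD] v.
have nu0 : nu 0 = 0 by rewrite -(scale0r v) nuZ normr0 mul0r.
have := nuD v (- v).
by rewrite subrr nu0 -scaleN1r nuZ normrN1 mul1r; lra.
Qed.

Lemma is_norm_sum (V : lmodType R) (nu : V -> R) : is_norm nu ->
  forall (I : finType) (v : I -> V), nu (\sum_i v i) <= \sum_i nu (v i).
Proof.
move=> hnu I v; have [_ nuZ nuD] := hnu.
elim/big_ind2: _ => [|a b c e ab ce|//].
  by rewrite -(scale0r 0) nuZ normr0 mul0r.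
by apply: (le_trans (nuD _ _)); apply: lerD.
Qed.

(** Expand [w] in the standard basis; the constant is the sum of the norms of the basis vectors. *)
Lemma is_norm_cV_le (N : nat) (nu : 'cV[R]_N -> R) : is_norm nu ->
  exists2 C, 0 <= C &
    forall (w : 'cV[R]_N) s, (forall i, `|w i 0| <= s) -> nu w <= C * s.
Proof.
move=> hnu; exists (\sum_i nu (delta_mx i 0)).
  by apply: sumr_ge0 => i _; exact: is_norm_ge0.
move=> w s ws; have -> : w = \sum_i w i 0 *: delta_mx i 0.
  by rewrite [LHS]matrix_sum_delta; apply: eq_bigr => i _; rewrite big_ord1.
apply: (le_trans (is_norm_sum hnu _)).
rewrite mulr_suml; apply: ler_sum => i _.
by rewrite (norm_homog hnu) mulrC ler_wpM2l ?is_norm_ge0.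
Qed.

(* Since [D *m E_ii = D_ii *: E_ii], submultiplicativity bounds each diagonal
   entry of D by its norm. *)
Lemma stepsize_le_matrix_norm (N : nat) (nu : 'M[R]_N -> R)
  (delta : nat -> 'I_N -> R) t i : is_matrix_norm nu ->
  `|delta t i| <= nu (stepsize_mx delta t).
Proof.
move=> [hnu nuM]; pose E : 'M[R]_N := delta_mx i i.
have E0 : 0 < nu E.
  rewrite lt0r is_norm_ge0// andbT; apply/eqP => /(norm_definite hnu).
  by move/matrixP/(_ i i)/eqP; rewrite !mxE !eqxx oner_eq0.
rewrite -(ler_pM2r E0) -(norm_homog hnu).
suff -> : delta t i *: E = stepsize_mx delta t *m E by exact: nuM.
apply/matrixP => j k; rewrite /stepsize_mx mul_diag_mx !mxE.
by have [->|_] := eqVneq j i; rewrite /= ?mulr0.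
Qed.

End Norms.

(** * Contraction by stochastic matrices and lower bounds on backward products *)

Section StochasticMatrices.
Variables (R : realType) (N : nat).
Implicit Types (A : 'M[R]_N) (P : nat -> 'M[R]_N).

Lemma convex_combination_norm_le (V : normedModType R) (w : 'I_N -> R)
    (v : 'I_N -> V) (c : V) (s : R) :
  (forall k, 0 <= w k) -> \sum_k w k = 1 -> (forall k, `|v k - c| <= s) ->
  `|\sum_k w k *: v k - c| <= s.
Proof.
move=> w0 w1 vs.
have -> : \sum_k w k *: v k - c = \sum_k w k *: (v k - c).
  rewrite -{1}(scale1r c) -w1 scaler_suml -sumrB.
  by apply: eq_bigr => k _; rewrite scalerBr.
apply: (le_trans (ler_norm_sum _ _ _)).
rewrite -[leRHS]mul1r -w1 mulr_suml; apply: ler_sum => k _.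
by rewrite normrZ ger0_norm// ler_wpM2l.
Qed.

(** Compare a single [v k] with the average along row [j]: the term of index [k] vanishes, and with
    it a weight of at least [eta]. Averaging over [k] along row [i] keeps the bound. *)
Lemma row_stochastic_contraction (V : normedModType R) A (v : 'I_N -> V)
    (eta s : R) :
  row_stochastic A -> (forall i j, eta <= A i j) ->
  (forall i j, `|v i - v j| <= s) ->
  forall i j, `|\sum_k A i k *: v k - \sum_k A j k *: v k| <= (1 - eta) * s.
Proof.
move=> [A0 A1] Aeta vs i j.
have s0 : 0 <= s by apply: le_trans (vs i i).
apply: convex_combination_norm_le => // k.
have -> : v k - \sum_l A j l *: v l = \sum_l A j l *: (v k - v l).
  rewrite -{1}(scale1r (v k)) -(A1 j) scaler_suml -sumrB.
  by apply: eq_bigr => l _; rewrite scalerBr.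
rewrite (bigD1 k)//= subrr scaler0 add0r.
apply: (le_trans (ler_norm_sum _ _ _)).
apply: (@le_trans _ _ (\sum_(l | l != k) A j l * s)).
  by apply: ler_sum => l _; rewrite normrZ ger0_norm// ler_wpM2l.
rewrite -mulr_suml ler_wpM2r//.
have := A1 j; rewrite (bigD1 k)//=; have := Aeta j k.
by move=> h <-; rewrite addrC -addrA lerDl subr_ge0.
Qed.

Lemma row_stochastic_mulmx A (B : 'M[R]_N) : row_stochastic A ->
  row_stochastic B -> row_stochastic (A *m B).
Proof.
move=> [A0 A1] [B0 B1]; split => [i j|i].
  by rewrite mxE sumr_ge0// => k _; rewrite mulr_ge0.
under eq_bigr do rewrite mxE.
rewrite exchange_big -[RHS](A1 i); apply: eq_bigr => k _ /=.
by rewrite -mulr_sumr B1 mulr1.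
Qed.

Lemma backward_product0 P t : backward_product P (t + 0)%N t = 1%:M.
Proof. by rewrite /backward_product addn0 subnn big_ord0. Qed.

Lemma backward_productS P t k :
  backward_product P (t + k.+1)%N t =
  P (t + k)%N *m backward_product P (t + k)%N t.
Proof.
rewrite /backward_product !addKn big_ord_recl /=; congr (P _ *m _).
  by rewrite addnS subn1.
by apply: eq_bigr => l _; rewrite addnS.
Qed.

Lemma backward_product_row_stochastic P t k :
  (forall s, row_stochastic (P s)) ->
  row_stochastic (backward_product P (t + k)%N t).
Proof.
move=> hP; elim: k => [|k IH]; last first.
  by rewrite backward_productS; apply: row_stochastic_mulmx.
rewrite backward_product0; split => [i j|i]; first by rewrite mxE ler0n.
rewrite (bigD1 i)//= big1 ?addr0 ?mxE ?eqxx// => j ji.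
by rewrite mxE eq_sym (negbTE ji).
Qed.

(** A positive entry of a product of [k] factors contains a path of [k] positive entries, each at
    least [p]. *)
Lemma backward_product_pos_ge P t k (p : R) :
  (forall s, row_stochastic (P s)) ->
  0 < p -> (forall s i j, 0 < P s i j -> p <= P s i j) ->
  forall i j, 0 < backward_product P (t + k)%N t i j ->
    p ^+ k <= backward_product P (t + k)%N t i j.
Proof.
move=> hP p0 hp; elim: k => [|k IH] i j.
  rewrite backward_product0 mxE expr0.
  by case: (i == j); rewrite ?lexx ?ltxx.
have [B0 _] := backward_product_row_stochastic t k hP.
rewrite backward_productS mxE.
set B := backward_product P (t + k)%N t in IH B0 *.
have [P0 _] := hP (t + k)%N.
move=> Bij; have [l /andP[Pl Bl]] :
    exists l, (0 < P (t + k)%N i l) && (0 < B l j).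
  apply/existsP; apply: contraTT Bij => /existsPn h.
  rewrite -leNgt sumr_le0// => l _.
  have := h l; rewrite negb_and -!leNgt => /orP[] h'.
    by apply: mulr_le0_ge0.
  by apply: mulr_ge0_le0.
rewrite (bigD1 l)//= exprS -[leLHS]addr0; apply: lerD.
  by apply: ler_pM; [exact: ltW|rewrite exprn_ge0// ltW|exact: hp|exact: IH].
by apply: sumr_ge0 => m _; rewrite mulr_ge0.
Qed.

Lemma inf_positive_entry_gt0 P : (0 < inf_positive_entry P)%E ->
  exists2 p, 0 < p & forall t i j, 0 < P t i j -> p <= P t i j.
Proof.
move=> P0; have Pinf t i j : 0 < P t i j ->
    (inf_positive_entry P <= (P t i j)%:E)%E.
  move=> Pij; apply: (@le_trans _ _
    (\big[mine/+oo%E]_(ij : 'I_N * 'I_N | 0 < P t ij.1 ij.2)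
       (P t ij.1 ij.2)%:E)).
    by apply: ereal_inf_lbound; exists t.
  exact: (bigmin_le_cond (j := (i, j)) +oo%E
    (fun ij => (P t ij.1 ij.2)%:E) Pij).
(* An infimum [+oo] would mean that no entry is positive, so any positive [p] would do. *)
case: (inf_positive_entry P) P0 Pinf => [p|_|//]; rewrite ?lte_fin.
  by move=> p0 h; exists p => // t i j /h; rewrite lee_fin.
by move=> h; exists 1 => // t i j /h; rewrite leye_eq.
Qed.

Lemma backward_product_uniform_lower_bound P T :
  (forall t, row_stochastic (P t)) -> (0 < inf_positive_entry P)%E ->
  (forall t, positive_mx (backward_product P (t + T)%N t)) ->
  exists eta, [/\ 0 < eta, eta <= 1 &
    forall t i j, eta <= backward_product P (t + T)%N t i j].
Proof.
move=> hP /inf_positive_entry_gt0[p p0 hp] hT.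
(* The minimum with 1 secures [eta <= 1], which makes the factor [1 - eta] nonnegative. *)
exists (Num.min 1 (p ^+ T)); split.
- by rewrite lt_min ltr01 exprn_gt0.
- by rewrite ge_min lexx.
- move=> t i j; rewrite ge_min; apply/orP; right.
  by apply: (backward_product_pos_ge hP p0 hp); exact: hT.
Qed.

End StochasticMatrices.

(** * The iterates, their weighted average and its convergence *)

Section Dynamics.
Variables (R : realType) (N d : nat) (f : 'I_N -> 'cV[R]_d -> R).
Variables (P : nat -> 'M[R]_N) (delta : nat -> 'I_N -> R).
Variables (x g : nat -> 'I_N -> 'cV[R]_d) (pi : nat -> 'cV[R]_N).
Variables (e m : nat -> R) (L eta : R) (T : nat) (i0 : 'I_N).
Hypothesis hP : forall t, row_stochastic (P t).
Hypothesis hx : forall t i,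
  x t.+1 i = \sum_(j < N) P t i j *: (x t j - delta t j *: g t j).
Hypothesis hg : forall t i, subdifferential (f i) (x t i) (g t i).
Hypothesis hpi : absolute_probability_vectors P pi.
Hypothesis delta_ge0 : forall t i, 0 <= delta t i.
Hypothesis delta_le : forall t i, delta t i <= e t.
Hypothesis L_ge0 : 0 <= L.
Hypothesis g_le : forall t i, norm1 (g t i) <= L.
Hypothesis f_lipschitz : forall i u v, f i u - f i v <= L * `|u - v|.
Hypothesis e_square_summable : bounded_series (fun t => e t ^+ 2).
Hypotheses (eta_gt0 : 0 < eta) (eta_le1 : eta <= 1).
Hypothesis eta_le : forall t i j, eta <= backward_product P (t + T)%N t i j.
Hypothesis m_summable : bounded_series m.
Hypothesis m_ge : forall t i j,
  `|pi t i 0 * delta t i - pi t j 0 * delta t j| <= m t.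

Let alpha t := pi t i0 0 * delta t i0.
Hypothesis alpha_divergent : ~ bounded_series alpha.

Let y t : 'cV[R]_d := \sum_i pi t i 0 *: x t i.
Let S t : R := \big[Num.max/0]_(ij : 'I_N * 'I_N) `|x t ij.1 - x t ij.2|.
Let fsum z : R := \sum_i f i z.

Let e_ge0 t : 0 <= e t.
Proof. exact: le_trans (delta_ge0 t i0) (delta_le t i0). Qed.

Let m_ge0 t : 0 <= m t.
Proof. by apply: le_trans (m_ge t i0 i0). Qed.

Let pi_ge0 t i : 0 <= pi t i 0.
Proof. by have [/(_ t)[]] := hpi. Qed.

Let pi_sum t : \sum_i pi t i 0 = 1.
Proof. by have [/(_ t)[]] := hpi. Qed.

Let pi_le1 t i : pi t i 0 <= 1.
Proof. by rewrite -(pi_sum t) (bigD1 i)//= lerDl sumr_ge0. Qed.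

Let alpha_ge0 t : 0 <= alpha t.
Proof. by rewrite mulr_ge0. Qed.

Let alpha_le t : alpha t <= e t.
Proof.
by apply: le_trans (delta_le t i0); rewrite -[leRHS]mul1r ler_wpM2r.
Qed.

Let step_le t i : `|delta t i *: g t i| <= L * e t.
Proof.
rewrite normrZ ger0_norm// mulrC; apply: ler_pM => //.
by apply: le_trans (g_le t i); exact: norm_le_norm1.
Qed.

Lemma diameter_ge t i j : `|x t i - x t j| <= S t.
Proof. exact: (le_bigmax _ (fun ij => `|x t ij.1 - x t ij.2|) (i, j)). Qed.

Lemma diameter_le t s : 0 <= s -> (forall i j, `|x t i - x t j| <= s) ->
  S t <= s.
Proof. by move=> s0 xs; apply: bigmax_le => // -[i j]. Qed.

Lemma diameter_ge0 t : 0 <= S t.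
Proof. exact: le_trans (diameter_ge t i0 i0). Qed.

Lemma average_dist_le t i : `|x t i - y t| <= S t.
Proof.
rewrite distrC; apply: convex_combination_norm_le => // k.
exact: diameter_ge.
Qed.

(* Compares the iterates with the unperturbed averaging started at time t. *)
Lemma diameter_contraction t :
  S (t + T)%N <= (1 - eta) * S t + 2 * L * \sum_(r < T) e (t + r)%N.
Proof.
pose v k i : 'cV[R]_d := \sum_j backward_product P (t + k)%N t i j *: x t j.
have vS k i : v k.+1 i = \sum_j P (t + k)%N i j *: v k j.
  rewrite /v; under [in RHS]eq_bigr do rewrite scaler_sumr.
  rewrite exchange_big; apply: eq_bigr => j _ /=.
  rewrite backward_productS mxE scaler_suml.
  by apply: eq_bigr => l _; rewrite scalerA.
(* Averaging does not enlarge earlier deviations, so each step adds only its own subgradient term,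
   of size at most [L * e (t + k)]. *)
have xv k i : `|x (t + k)%N i - v k i| <= L * \sum_(r < k) e (t + r)%N.
  elim: k i => [|k IH] i.
    rewrite big_ord0 mulr0 normr_le0 subr_eq0 addn0 /v.
    rewrite (bigD1 i)//= big1 ?addr0.
      by rewrite backward_product0 mxE eqxx scale1r.
    by move=> j ji; rewrite backward_product0 mxE eq_sym (negbTE ji) scale0r.
  rewrite addnS hx vS -sumrB big_ord_recr /=.
  under eq_bigr do rewrite -scalerBr.
  rewrite -[X in `|X|]subr0; have [P0 P1] := hP (t + k)%N.
  apply: convex_combination_norm_le => // j.
  rewrite subr0 addrAC mulrDr; apply: (le_trans (ler_normB _ _)).
  exact: lerD.
have s0 : 0 <= \sum_(r < T) e (t + r)%N by apply: sumr_ge0.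
apply: diameter_le => [|i j].
  by rewrite addr_ge0 ?mulr_ge0 ?subr_ge0 ?diameter_ge0.
have vv : `|v T i - v T j| <= (1 - eta) * S t.
  apply: row_stochastic_contraction => //; last exact: diameter_ge.
  exact: backward_product_row_stochastic.
have -> : x (t + T)%N i - x (t + T)%N j = (x (t + T)%N i - v T i) +
    (v T i - v T j) - (x (t + T)%N j - v T j).
  by apply/colP => l; rewrite !mxE; ring.
apply: (le_trans (ler_normB _ _)).
have := ler_normD (x (t + T)%N i - v T i) (v T i - v T j).
by have := xv T i; have := xv T j; lra.
Qed.

Lemma diameter_square_summable : bounded_series (fun t => S t ^+ 2).
Proof.
apply: (@delayed_contraction_square_summable _ S e T (2 * L) eta) => //.
- by rewrite mulr_ge0.
- exact: diameter_ge0.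
- exact: diameter_contraction.
Qed.

(** The identity [(pi t.+1)^T *m P t = (pi t)^T] absorbs the mixing matrix, so only the subgradient
    terms move the average. *)
Lemma average_step t :
  y t.+1 = y t - \sum_j (pi t j 0 * delta t j) *: g t j.
Proof.
rewrite /y -sumrB; under eq_bigr do rewrite hx scaler_sumr.
rewrite exchange_big; apply: eq_bigr => j _ /=.
under eq_bigr do rewrite scalerA.
rewrite -scaler_suml.
have -> : \sum_i pi t.+1 i 0 * P t i j = pi t j 0.
  have [_ /(_ t)/rowP/(_ j)] := hpi; rewrite !mxE => <-.
  by apply: eq_bigr => i _; rewrite mxE.
by rewrite scalerBr scalerA.
Qed.

(** Two replacements are paid for: moving from [x t j] to [y t] costs [2 * L * S t], and replacing
    the weight of [j] by [alpha t] costs [m t] times the size of the inner product. *)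
Lemma weighted_descent t z j :
  alpha t * (f j (y t) - f j z - 2 * L * S t) -
    L * m t * (1 + dotv (y t - z) (y t - z)) <=
  pi t j 0 * delta t j * dotv (g t j) (y t - z).
Proof.
set U := dotv (y t - z) (y t - z); set D := dotv (g t j) (y t - z).
(* Bounding the distance by [1 + U] keeps the error affine in [U], as the quasi-Fejer recursion
   requires. *)
have normU : `|y t - z| <= 1 + U.
  by have := sqr_norm_le_dotv (y t - z); rewrite -/U; nra.
have DU : `|D| <= L * (1 + U).
  by apply: (le_trans (dotv_norm_le _ _)); apply: ler_pM => //;
      exact: norm1_ge0.
have xy := average_dist_le t j.
have yx : `|y t - x t j| <= S t by rewrite distrC.
have Dlow : f j (y t) - f j z - 2 * L * S t <= D.
  have DE : D = dotv (g t j) (y t - x t j) - dotv (g t j) (z - x t j).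
    by rewrite -dotvBr opprB addrA subrK.
  have := hg t j z; have := f_lipschitz j (y t) (x t j).
  have := ler_wpM2l L_ge0 yx.
  have : `|dotv (g t j) (y t - x t j)| <= L * S t.
    by apply: (le_trans (dotv_norm_le _ _)); apply: ler_pM => //;
      exact: norm1_ge0.
  by rewrite ler_norml => /andP[]; rewrite DE; lra.
have mD : `|(pi t j 0 * delta t j - alpha t) * D| <= m t * (L * (1 + U)).
  by rewrite normrM; apply: ler_pM => //; exact: m_ge.
have := ler_wpM2l (alpha_ge0 t) Dlow.
by move: mD; rewrite ler_norml => /andP[]; lra.
Qed.

(** Expand the square of [(y t - z) - w]. Summing [weighted_descent] over [j] bounds the cross term
    and produces the factors [N%:R]; [dotv w w] is of order [e t ^+ 2]. *)
Lemma average_descent t z :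
  dotv (y t.+1 - z) (y t.+1 - z) <=
    (1 + 2 * N%:R * L * m t) * dotv (y t - z) (y t - z)
    - 2 * (alpha t * (fsum (y t) - fsum z))
    + (2 * N%:R * L * m t + (2 * N%:R * L + L ^+ 2) * e t ^+ 2
       + 2 * N%:R * L * S t ^+ 2).
Proof.
set w := \sum_j (pi t j 0 * delta t j) *: g t j.
have yE : y t.+1 - z = (y t - z) - w by rewrite average_step addrAC.
have wle : norm1 w <= L * e t.
  apply: (le_trans (norm1_sum _)).
  apply: (@le_trans _ _ (\sum_j pi t j 0 * (L * e t))); last first.
    by rewrite -mulr_suml pi_sum mul1r.
  apply: ler_sum => j _; rewrite norm1Z ger0_norm ?mulr_ge0// -mulrA.
  by rewrite ler_wpM2l// mulrC; apply: ler_pM => //; exact: norm1_ge0.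
have ww : dotv w w <= L ^+ 2 * e t ^+ 2.
  apply: (le_trans (ler_norm _)); apply: (le_trans (dotv_norm_le _ _)).
  rewrite -exprMn expr2; apply: ler_pM => //; first exact: norm1_ge0.
  exact: le_trans (norm_le_norm1 w) wle.
have wyz : alpha t * (fsum (y t) - fsum z) -
    N%:R * (alpha t * (2 * L * S t)) -
    N%:R * (L * m t * (1 + dotv (y t - z) (y t - z))) <= dotv w (y t - z).
  rewrite dotv_suml /fsum -sumrB mulr_sumr.
  have sumC (a : R) : N%:R * a = \sum_(j < N) a.
    by rewrite sumr_const card_ord mulr_natl.
  rewrite !sumC -!sumrB.
  apply: ler_sum => j _; rewrite dotvZl.
  by apply: le_trans (weighted_descent t z j); lra.
(* Splits the mixed error into the two square summable sequences. *)
have aS : 2 * (alpha t * S t) <= e t ^+ 2 + S t ^+ 2.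
  have := ler_wpM2r (diameter_ge0 t) (alpha_le t).
  by have := sqr_ge0 (e t - S t); lra.
have NL0 : 0 <= N%:R * L :> R by rewrite mulr_ge0.
have := ler_wpM2l NL0 aS.
by rewrite yE (dotvBB (y t - z)); lra.
Qed.

Lemma average_quasi_fejer z (U := fun t => dotv (y t - z) (y t - z))
    (F := fun t => fsum (y t) - fsum z) :
  is_minimizer fsum z ->
  [/\ exists B, forall t, U t <= B,
      bounded_series (fun t => alpha t * F t) &
      (forall eps n, 0 < eps -> exists2 t, (n <= t)%N & U t < eps) ->
      forall eps, 0 < eps -> exists n, forall t, (n <= t)%N -> U t < eps].
Proof.
move=> zmin.
have F0 t : 0 <= F t by rewrite subr_ge0.
have U0 t : 0 <= U t by exact: dotvv_ge0.
pose c t := 2 * N%:R * L * m t.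
pose b t := 2 * N%:R * L * m t + (2 * N%:R * L + L ^+ 2) * e t ^+ 2
  + 2 * N%:R * L * S t ^+ 2.
have NL0 : 0 <= 2 * N%:R * L :> R by rewrite !mulr_ge0.
have K0 : 0 <= 2 * N%:R * L + L ^+ 2 by rewrite addr_ge0// sqr_ge0.
have c0 t : 0 <= c t by rewrite mulr_ge0.
have b0 t : 0 <= b t by rewrite !addr_ge0// mulr_ge0// sqr_ge0.
have cB : bounded_series c by exact: bounded_seriesZ.
have bB : bounded_series b.
  apply: bounded_seriesD; last first.
    by apply: bounded_seriesZ => //; exact: diameter_square_summable.
  by apply: bounded_seriesD => //; apply: bounded_seriesZ.
(* One of the two copies of [alpha t * F t] is dropped, being nonnegative. *)
have UE t : U t.+1 <= (1 + c t) * U t - alpha t * F t + b t.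
  by have := average_descent t z; have := mulr_ge0 (alpha_ge0 t) (F0 t);
     rewrite /U /F /c /b; lra.
split.
- exact: (quasi_fejer_bounded U0 F0 alpha_ge0 b0 c0 bB cB UE).
- exact: (quasi_fejer_summable U0 F0 alpha_ge0 b0 c0 bB cB UE).
- exact: (quasi_fejer_cvg0 U0 F0 alpha_ge0 b0 c0 bB cB UE).
Qed.

Lemma fsum_lipschitz u v : fsum u - fsum v <= N%:R * L * `|u - v|.
Proof.
rewrite /fsum -sumrB -mulrA mulr_natl -[X in _ *+ X]card_ord -sumr_const.
exact: ler_sum.
Qed.

(** Take a cluster point along times [tau k] at which the gap to the minimum is below [k.+1%:R^-1];
    Lipschitz continuity passes the vanishing gap to that point. *)
Lemma average_cluster_minimizer : (exists z, is_minimizer fsum z) ->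
  exists2 p, is_minimizer fsum p &
    forall eps n, 0 < eps -> exists2 t, (n <= t)%N & `|y t - p| < eps.
Proof.
move=> [z zmin]; have [[B hB] sumF _] := average_quasi_fejer zmin.
have F0 t : 0 <= fsum (y t) - fsum z by rewrite subr_ge0.
have : forall k : nat, exists t, (k <= t)%N /\ fsum (y t) - fsum z < k.+1%:R^-1.
  move=> k; have [|t kt h] := series_dominate_liminf0 alpha_ge0 alpha_divergent
    sumF F0 (eps := k.+1%:R^-1) k; first by rewrite invr_gt0.
  by exists t.
move=> /choice[tau htau].
(* The bound uses [s <= 1 + s ^+ 2] for the distance [s] from [y] to [z]. *)
have [|p hp] := @bounded_cluster_point _ _ (y \o tau) (1 + B + `|z|).
  move=> k /=; have := hB (tau k); have := sqr_norm_le_dotv (y (tau k) - z).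
  have := ler_normD (y (tau k) - z) z; rewrite subrK.
  by nra.
exists p => [u|eps n eps0]; last first.
  have [k nk hk] := hp _ n eps0; exists (tau k) => //.
  by apply: leq_trans nk _; case: (htau k).
apply: le_trans (zmin u); apply/ler_addgt0Pr => eps eps0.
have K0 : 0 < N%:R * L + 1 by rewrite ltr_wpDl// mulr_ge0.
have eps20 : 0 < eps / 2 by rewrite divr_gt0.
(* An index this large makes [k.+1%:R^-1 < eps / 2]; the denominator [N%:R * L + 1] is positive even
   if [L = 0]. *)
have [k nk hk] := hp _ (Num.bound (eps / 2)^-1) (divr_gt0 eps20 K0).
have [_ hF] := htau k.
have kE : k.+1%:R^-1 < eps / 2.
  rewrite -[ltRHS]invrK ltf_pV2 ?posrE ?invr_gt0//.
  apply: lt_le_trans (archi_boundP _) _; first by rewrite invr_ge0 ltW.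
  by rewrite ler_nat; apply: leqW.
have := fsum_lipschitz p (y (tau k)); rewrite distrC.
move: hk; rewrite /= ltr_pdivlMr// => hk.
have := normr_ge0 (y (tau k) - p); have := lt_trans hF kE; move=> {hF kE}; lra.
Qed.

Lemma iterates_converge : (exists z, is_minimizer fsum z) ->
  exists xstar, is_minimizer fsum xstar /\
    forall i, x t i @[t --> \oo] --> xstar.
Proof.
move=> /average_cluster_minimizer[p pmin hp]; exists p; split=> // i.
have [_ _ Ucvg] := average_quasi_fejer pmin.
have {}Ucvg : forall eps : R, 0 < eps -> exists n : nat,
    forall t, (n <= t)%N -> dotv (y t - p) (y t - p) < eps.
  apply: Ucvg => eps n eps0.
  have d0 : 0 < d%:R + 1 :> R by rewrite ltr_wpDl.
  (* Below 1 the square of the norm is at most the norm, so [dotv] is at most [d%:R] times the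
     norm. *)
  have [|t nt ht] := hp (Num.min 1 (eps / (d%:R + 1))) n.
    by rewrite lt_min ltr01 divr_gt0.
  exists t => //; apply: le_lt_trans (dotvv_le_sqr _) _.
  move: ht; rewrite lt_min ltr_pdivlMr// => /andP[h1 h2].
  apply: (le_lt_trans _ h2); rewrite mulrC mulrDr mulr1.
  have n0 := normr_ge0 (y t - p).
  have : `|y t - p| ^+ 2 <= `|y t - p| by nra.
  by move/(ler_wpM2r (ler0n R d)); lra.
apply/cvgrPdist_lt => eps eps0.
have eps20 : 0 < eps / 2 by rewrite divr_gt0.
(* The extra half turns the non-strict tail bound into a strict bound on each single [S t ^+ 2]. *)
have eps40 : 0 < (eps / 2) ^+ 2 / 2 by rewrite divr_gt0// exprn_gt0.
have [n1 hn1] := Ucvg _ (exprn_gt0 2 eps20).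
have [n2 hn2] := bounded_series_tail (fun t => sqr_ge0 (S t))
  diameter_square_summable eps40.
exists (n1 + n2)%N => // t /= nt.
have yt : `|y t - p| < eps / 2.
  rewrite -ltr_sqr ?nnegrE ?(ltW eps20)//.
  apply: le_lt_trans (sqr_norm_le_dotv _) _.
  by apply: hn1; apply: leq_trans nt; exact: leq_addr.
have St : S t < eps / 2.
  rewrite -ltr_sqr ?nnegrE ?diameter_ge0 ?(ltW eps20)//.
  have n2t : (n2 <= t)%N by apply: leq_trans nt; exact: leq_addl.
  have := hn2 (t - n2).+1; rewrite big_ord_recr /= subnKC//.
  have : 0 <= \sum_(s < t - n2) S (n2 + s)%N ^+ 2.
    by apply: sumr_ge0 => s _; exact: sqr_ge0.
  have := exprn_gt0 2 eps20; lra.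
have := ler_normD (x t i - y t) (y t - p); rewrite addrA subrK distrC.
by have := average_dist_le t i; lra.
Qed.

End Dynamics.

(** * Passage from the stated hypotheses to those of the dynamics *)

Theorem corollary5p1 (R : realType) (N d : nat) (hN : (0 < N)%N) (hd : (0 < d)%N)
  (normM : 'M[R]_N -> R) (hnormM : is_matrix_norm normM)
  (normV : 'cV[R]_N -> R) (hnormV : is_norm normV)
  (f : 'I_N -> 'cV[R]_d -> R)
  (hconv : forall i, convex_function [set: 'cV[R]_d] (f i))
  (hL : forall i, (subgradient_sup (f i) < +oo)%E)
  (hmin : exists z, is_minimizer (fun y => \sum_(i < N) f i y) z)
  (P : nat -> 'M[R]_N) (hP : forall t, row_stochastic (P t))
  (delta : nat -> 'I_N -> R)
  (x g : nat -> 'I_N -> 'cV[R]_d)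
  (hx : forall t i,
     x t.+1 i = \sum_(j < N) P t i j *: (x t j - delta t j *: g t j))
  (hg : forall t i, subdifferential (f i) (x t i) (g t i))
  (hPinf : (0 < inf_positive_entry P)%E)
  (hPpos : exists T : nat,
     forall t : nat, positive_mx (backward_product P (t + T)%N t))
  (hdelta0 : forall t i, 0 <= delta t i)
  (hdelta : (\sum_(0 <= t <oo)
     ((normM (stepsize_mx delta t))%:E *
      ereal_sup [set (normM (stepsize_mx delta l))%:E
                | l in [set l : nat | (t <= l)%N]]) < +oo)%E)
  (pi : nat -> 'cV[R]_N) (hpi : absolute_probability_vectors P pi)
  (hdiv : (\sum_(0 <= t <oo) (normV (stepsize_mx delta t *m pi t))%:E = +oo)%E)
  (hsqrt : (\sum_(0 <= t <oo)
     (Num.sqrt t%:R * max_discrepancy pi delta t)%:E < +oo)%E) :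
  exists xstar : 'cV[R]_d,
    is_minimizer (fun y => \sum_(i < N) f i y) xstar /\
    forall i, x t i @[t --> \oo] --> xstar.
Proof.
pose i0 := Ordinal hN.
pose e t := normM (stepsize_mx delta t).
pose m t := max_discrepancy pi delta t.
have deltae t i : delta t i <= e t.
  by apply: le_trans (ler_norm _) _; exact: stepsize_le_matrix_norm.
have e0 t : 0 <= e t by exact: le_trans (hdelta0 t i0) (deltae t i0).
(* The supremum over [l >= t] includes [l = t], so each summand dominates a square. *)
have eB : bounded_series (fun t => e t ^+ 2).
  apply: bounded_series_nneseries => [t|]; first exact: sqr_ge0.
  apply: le_lt_trans hdelta; apply: lee_nneseries => t _.
    by rewrite lee_fin sqr_ge0.
  rewrite expr2 EFinM; apply: lee_wpmul2l; first by rewrite lee_fin.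
  by apply: ereal_sup_ubound; exists t => /=.
have m_ge t i j : `|pi t i 0 * delta t i - pi t j 0 * delta t j| <= m t.
  exact: (le_bigmax _ (fun ij => `|pi t ij.1 0 * delta t ij.1 -
    pi t ij.2 0 * delta t ij.2|) (i, j)).
have m0 t : 0 <= m t by exact: le_trans (m_ge t i0 i0).
have mB : bounded_series m.
  have sB : bounded_series (fun t => Num.sqrt t%:R * m t).
    by apply: bounded_series_nneseries => // t; rewrite mulr_ge0 ?sqrtr_ge0.
  (* The weight [Num.sqrt t%:R] is at least 1 for [t >= 1] but vanishes at [t = 0], so [m 0] is
     added separately. *)
  have tB : bounded_series (fun t => if t == 0%N then m 0%N else 0).
    exists (m 0%N) => -[|n]; first by rewrite big_ord0.
    by rewrite big_ord_recl big1 ?addr0.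
  apply: bounded_series_le (bounded_seriesD sB tB) => -[|t] /=.
    by rewrite sqrtr0 mul0r add0r.
  by rewrite addr0 -[leLHS]mul1r ler_wpM2r// -[leLHS]sqrtr1 ler_wsqrtr// ler1n.
have pi0 t i : 0 <= pi t i 0 by have [/(_ t)[]] := hpi.
(* Each entry of [stepsize_mx delta t *m pi t] is at most [alpha t + m t], with [alpha t] the entry
   at [i0]; summability of [alpha] would contradict [hdiv]. *)
have alphaD : ~ bounded_series (fun t => pi t i0 0 * delta t i0).
  move=> aB; have [C C0 hC] := is_norm_cV_le hnormV.
  suff : (\sum_(0 <= t <oo) (normV (stepsize_mx delta t *m pi t))%:E < +oo)%E.
    by rewrite hdiv ltxx.
  apply: nneseries_bounded_series => [t|]; first exact: is_norm_ge0.
  apply: bounded_series_le (bounded_seriesZ C0 (bounded_seriesD aB mB)) => t.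
  apply: hC => i; rewrite /stepsize_mx mul_diag_mx !mxE mulrC.
  rewrite ger0_norm ?mulr_ge0//.
  by have := m_ge t i i0; rewrite ler_norml => /andP[]; lra.
have /choice[Lf hLf] : forall i, exists L, 0 <= L /\
    forall z h, subdifferential (f i) z h -> norm1 h <= L.
  by move=> i; have [L] := subgradient_sup_bound (hL i); exists L.
pose L := \sum_i Lf i.
have Lf0 i : 0 <= Lf i by case: (hLf i).
have L0 : 0 <= L by exact: sumr_ge0.
have LfL i : Lf i <= L by rewrite /L (bigD1 i)//= lerDl sumr_ge0.
have subL i z h : subdifferential (f i) z h -> norm1 h <= L.
  by move=> hz; apply: le_trans (LfL i); case: (hLf i) => _; apply; exact: hz.
have [T hT] := hPpos.
have [eta [eta0 eta1 etaE]] := backward_product_uniform_lower_bound hP hPinf hT.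
apply: (iterates_converge (e := e) (m := m) (L := L) (eta := eta) (T := T)
  (i0 := i0) hP hx hg hpi) => //.
- by move=> t i; exact: subL (hg t i).
- by move=> i u v; apply: bounded_subgradients_lipschitz => //; exact: subL.
Qed.
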